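(* Let $C_{\mathrm G}=\frac{5\cdot 3^{4/5}}{\pi^{7/5}}\approx 2.42493$ and let $Z_d\sim\mathcal N(0,1/d)$. Then for every dimension $d=2^m$ ($m\ge1$ an integer), \[ \sup_{u\in S^{d-1}}\ \sup_{1\le k\le d}\ \mathrm{K}\bigl([T(u)]_k,Z_d\bigr)\le C_{\mathrm G}\,d^{-1/5}. \]
   Context: $H$ is the unnormalized $d\times d$ Walsh--Hadamard matrix ($H_1=(1)$, $H_{2n}=\begin{pmatrix}H_n&H_n\\H_n&-H_n\end{pmatrix}$). $D^{(1)},D^{(2)}$ are independent diagonal matrices with i.i.d. Rademacher diagonal entries. For deterministic $u\in S^{d-1}$ (the unit sphere), $T(u)=\frac1d HD^{(1)}HD^{(2)}u$, and $[v]_k$ is the $k$th coordinate. $\mathrm{K}(A,B)=\sup_{t\in\mathbb{R}}|\mathbb{P}(A\le t)-\mathbb{P}(B\le t)|$ is the Kolmogorov distance. *)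

(* Defs.v *)
From HB Require Import structures.
From mathcomp Require Import all_boot all_order all_algebra.
From mathcomp Require Import all_classical all_reals all_analysis.
Set Implicit Arguments. Unset Strict Implicit. Unset Printing Implicit Defensive.
Import Order.TTheory GRing.Theory Num.Theory.
Local Open Scope ring_scope.

(* Unnormalized Walsh--Hadamard matrix H_{2^m}, given through its entries on
   natural-number indices, following the recursion
   H_1 = (1),  H_{2n} = [[H_n, H_n], [H_n, -H_n]]  with n = 2^m:
   entry (i,j) of H_{2n} is the entry (i mod n, j mod n) of H_n, negated
   exactly when both i >= n and j >= n (the bottom-right block). *)
Fixpoint hadamard_entry {R : ringType} (m i j : nat) : R :=
  match m with
  | 0 => 1
  | m'.+1 =>
      let n := (2 ^ m')%N in
      (if (n <= i)%N && (n <= j)%N then -1 else 1) *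
      hadamard_entry m' (i %% n) (j %% n)
  end.

Definition hadamard {R : ringType} (m : nat) : 'M[R]_(2 ^ m) :=
  \matrix_(i, j) hadamard_entry m i j.

Definition rad_diag {R : ringType} (d : nat) (s : {ffun 'I_d -> bool}) : 'M[R]_d :=
  diag_mx (\row_i (if s i then -1 else 1)).

Definition Tmap {R : fieldType} (m : nat) (s1 s2 : {ffun 'I_(2 ^ m) -> bool})
  (u : 'cV[R]_(2 ^ m)) : 'cV[R]_(2 ^ m) :=
  ((2 ^ m)%:R)^-1 *: (hadamard m *m rad_diag s1 *m hadamard m *m rad_diag s2 *m u).

(* P([T(u)]_k <= t), where D1, D2 have independent i.i.d. Rademacher
   diagonals: uniform probability on the 2^(2d) pairs of sign patterns. *)
Definition prob_T_le {R : realFieldType} (m : nat) (u : 'cV[R]_(2 ^ m))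
  (k : 'I_(2 ^ m)) (t : R) : R :=
  #|[set p : {ffun 'I_(2 ^ m) -> bool} * {ffun 'I_(2 ^ m) -> bool}
       | Tmap p.1 p.2 u k ord0 <= t]|%:R / (2 ^ (2 * 2 ^ m))%:R.

(* P(Z_d <= t) for Z_d ~ N(0, 1/d) (standard deviation sqrt(1/d)). *)
Definition gauss_cdf {R : realType} (d : nat) (t : R) : \bar R :=
  normal_prob 0 (Num.sqrt (d%:R^-1)) `]-oo, t]%classic.

Definition C_G {R : realType} : R :=
  5 * (3 `^ (4 / 5)) / (pi `^ (7 / 5)).

(* Main.v *)
Require Import Defs.
From HB Require Import structures.
From mathcomp Require Import all_boot all_order all_algebra.
From mathcomp Require Import all_classical all_reals all_analysis.
From mathcomp Require Import measurable_realfun normal_distribution.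
From mathcomp Require Import ring lra.
Import Order.TTheory GRing.Theory Num.Theory.
Import numFieldNormedType.Exports.
Local Open Scope classical_set_scope.
Local Open Scope ring_scope.
Set Implicit Arguments. Unset Strict Implicit. Unset Printing Implicit Defensive.

(** Conditionally on the inner signs [D2], the coordinate [T(u)_k] is a
    Rademacher sum [W = \sum_j a_j e_j] with [a_j = H_kj (H D2 u)_j / d], whose
    variance is exactly [s^2 = 1/d] because the columns of [H] are orthogonal.
    Instead of Esseen's smoothing inequality we use Stein's method: the
    indicator of [x <= t] is replaced by a ramp [h] of width [del], and
    [f' - x f / s^2 = h - E h(Z)] is solved by an explicit [f] with [|f'| <= 1]
    and [|f| <= 6 s / 5].  Flipping one sign at a time gives
    [E (W f(W)) = \sum_j E (b_j (f(W) - f(W - 2 b_j)) / 2)] with [b_j = a_j e_j],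
    so that [E h(W) - E h(Z)] is a sum of trapezoidal errors for [f'], of order
    [\sum_j |a_j|^3].  The same identity applied to powers yields the fourth
    moment bound [E (H D2 u)_j^4 <= 3], hence
    [E \sum_j |a_j|^3 <= (97/56) / d^2].  With [del = 2 s d^(-1/5)] the total
    error is below [C_G d^(-1/5)] once [d >= 128]; for [d <= 64] the right-hand
    side is at least 1. *)

(** * Monotonicity, mean values and an upper bound on [pi] *)

Section monotone.
Context {R : realType}.
Implicit Types f df : R -> R.

Lemma is_derive_within_continuous f df (A : set R) :
  (forall x : R, is_derive x 1 f (df x)) -> {within A, continuous f}.
Proof.
move=> dfE; apply: continuous_subspaceT => x.
have [dx _] := dfE x.
exact/differentiable_continuous/derivable1_diffP.
Qed.

Lemma derive_ge0_le f df (a b : R) : a <= b ->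
  (forall x : R, is_derive x 1 f (df x)) ->
  (forall x, a < x < b -> 0 <= df x) -> f a <= f b.
Proof.
move=> ab dfE df0; move: ab; rewrite le_eqVlt => /predU1P[->//|ab].
have [c cab] := MVT ab (fun x _ => dfE x) (is_derive_within_continuous dfE).
rewrite -subr_ge0 => ->; rewrite mulr_ge0 ?subr_ge0 ?(ltW ab)//.
by apply: df0; rewrite in_itv in cab.
Qed.

Lemma derive_le0_ge f df (a b : R) : a <= b ->
  (forall x : R, is_derive x 1 f (df x)) ->
  (forall x, a < x < b -> df x <= 0) -> f b <= f a.
Proof.
move=> ab dfE df0; rewrite -lerN2.
apply: (@derive_ge0_le (- f) (- df)) => // x xab.
by rewrite oppr_ge0 df0.
Qed.

(** Order-free and on a closed interval, because the values of a Rademacher sum before and after a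
    sign flip come in either order and may coincide. *)
Lemma mean_value f df (x y : R) :
  (forall x : R, is_derive x 1 f (df x)) ->
  exists2 c, Num.min x y <= c <= Num.max x y & f x - f y = (x - y) * df c.
Proof.
move=> dfE; wlog xy : x y / y <= x => [hw|].
  have /orP[yx|xy] := le_total y x; first exact: hw.
  have [c cxy fE] := hw y x xy; exists c; first by rewrite minC maxC.
  by rewrite -opprB fE -mulNr opprB.
have [c cab fE] :=
  MVT_segment xy (fun z _ => dfE z) (is_derive_within_continuous dfE).
exists c; last by rewrite fE mulrC.
by move: cab; rewrite in_itv/= (min_idPr xy) (max_idPl xy).
Qed.

End monotone.

Section pi_bound.
Context {R : realType}.

(** Start of a chain of Taylor bounds: each difference of sides vanishes at 0, and its derivative is
    nonnegative by the preceding bound. *)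
Lemma sin_le_id (x : R) : 0 <= x -> sin x <= x.
Proof.
move=> x0; rewrite -subr_ge0.
have := @derive_ge0_le R (fun y => y - sin y) (fun y => 1 - cos y) 0 x x0.
rewrite sin0 subr0; by apply => y _; rewrite subr_ge0 cos_le1.
Qed.

Lemma cos_ge_deg2 (x : R) : 0 <= x -> 1 - x ^+ 2 / 2 <= cos x.
Proof.
move=> x0; rewrite -subr_ge0.
have := @derive_ge0_le R (fun y => cos y - (1 - y ^+ 2 / 2))
   (fun y => y - sin y) 0 x x0.
rewrite cos0 expr0n/= mul0r subr0 subrr; apply => y.
- by apply: is_derive_eq; rewrite /GRing.scale/=; field.
- by move=> /andP[/ltW y0 _]; rewrite subr_ge0 sin_le_id.
Qed.

Lemma sin_ge_deg3 (x : R) : 0 <= x -> x - x ^+ 3 / 6 <= sin x.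
Proof.
move=> x0; rewrite -subr_ge0.
have := @derive_ge0_le R (fun y => sin y - (y - y ^+ 3 / 6))
   (fun y => cos y - (1 - y ^+ 2 / 2)) 0 x x0.
rewrite sin0 expr0n/= mul0r !subr0; apply => y.
- by apply: is_derive_eq; rewrite /GRing.scale/=; field.
- by move=> /andP[/ltW y0 _]; rewrite subr_ge0 cos_ge_deg2.
Qed.

Lemma cos_le_deg4 (x : R) : 0 <= x -> cos x <= 1 - x ^+ 2 / 2 + x ^+ 4 / 24.
Proof.
move=> x0; rewrite -subr_ge0.
have := @derive_ge0_le R (fun y => 1 - y ^+ 2 / 2 + y ^+ 4 / 24 - cos y)
   (fun y => sin y - (y - y ^+ 3 / 6)) 0 x x0.
rewrite cos0 !expr0n/= !mul0r subr0 addr0 subrr; apply => y.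
- by apply: is_derive_eq; rewrite /GRing.scale/=; field.
- by move=> /andP[/ltW y0 _]; rewrite subr_ge0 sin_ge_deg3.
Qed.

(** Otherwise [8 / 5] would lie below [pi / 2] and have a positive cosine, while the quartic bound
    there is about -0.007. *)
Lemma pi_le_3_2 : pi <= 16 / 5 :> R.
Proof.
rewrite leNgt; apply/negP => pi_gt.
have c0 : 0 < cos (8 / 5 : R).
  by apply: cos_gt0_pihalf; apply/andP; split; have := @pi_gt0 R; lra.
have c1 : cos (8 / 5 : R) <= _ := cos_le_deg4 _.
have := lt_le_trans c0 (c1 _); lra.
Qed.

End pi_bound.

(** * Weighted Gaussian integrals *)

Section gauss.
Context {R : realType}.
Variable sigma : R.
Hypothesis sigma_gt0 : 0 < sigma.

Local Notation mu := (@lebesgue_measure R).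
Local Notation p := (normal_pdf 0 sigma).

Let sigma_neq0 : sigma != 0. Proof. by rewrite gt_eqF. Qed.

Lemma normal_pdf0E x :
  p x = normal_peak sigma * expR (- (x ^+ 2 / (sigma ^+ 2 *+ 2))).
Proof. by rewrite normal_pdfE// /normal_fun subr0 mulNr. Qed.

Lemma normal_pdf_gt0 x : 0 < p x.
Proof. by rewrite normal_pdf0E mulr_gt0 ?expR_gt0// normal_peak_gt0. Qed.

Lemma is_derive_normal_pdf (x : R) :
  is_derive x 1 p (- (x / sigma ^+ 2) * p x).
Proof.
have -> : p = normal_peak sigma *:
    (expR \o (fun y : R => (- (sigma ^+ 2 *+ 2)^-1) *: y ^+ 2)).
  apply/funext => y; rewrite normal_pdf0E /GRing.scale/=; congr (_ * expR _).
  by rewrite mulNr mulrC.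
apply: is_derive_eq; rewrite /GRing.scale/=.
set E := expR _; rewrite -[normal_peak sigma *: E]/(normal_peak sigma * E).
by rewrite -(mulr_natl _ 2); field.
Qed.

Definition gauss_int (h : R -> R) (A : set R) : R :=
  \int[mu]_(y in A) (h y * p y).

Definition gauss_cdfr (x : R) : R := fine (normal_prob 0 sigma `]-oo, x]).
Local Notation P := gauss_cdfr.

Lemma gauss_cdfrE x : P x = gauss_int (cst 1) `]-oo, x].
Proof.
rewrite /P /gauss_int /normal_prob /Rintegral; congr fine.
by apply: eq_integral => y _; rewrite mul1r.
Qed.

Lemma gauss_cdfr_EFin x : normal_prob 0 sigma `]-oo, x] = (P x)%:E.
Proof. by rewrite /P fineK// fin_num_measure. Qed.

Lemma gauss_cdfr_ge0 x : 0 <= P x.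
Proof. by rewrite -lee_fin -gauss_cdfr_EFin. Qed.

Lemma gauss_cdfr_le1 x : P x <= 1.
Proof. by rewrite -lee_fin -gauss_cdfr_EFin probability_le1. Qed.

Lemma gauss_cdfr_cvgy : P x @[x --> +oo] --> (1 : R).
Proof.
(* The identity, packed as a random variable on the Gaussian space, has [P] as its distribution
   function. *)
pose idr : measurableTypeR R -> R := idfun.
pose mid := @isMeasurableFun.Build _ _ _ _ idr (@measurable_id _ _ setT).
pose X : {RV (normal_prob 0 sigma) >-> R} := HB.pack idr mid.
have /fine_cvg := @cvg_cdfy1 _ _ _ (normal_prob 0 sigma) X.
by [].
Qed.

Lemma gauss_cdfr_cvgNy : P x @[x --> -oo] --> (0 : R).
Proof.
pose idr : measurableTypeR R -> R := idfun.
pose mid := @isMeasurableFun.Build _ _ _ _ idr (@measurable_id _ _ setT).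
pose X : {RV (normal_prob 0 sigma) >-> R} := HB.pack idr mid.
have /fine_cvg := @cvg_cdfNy0 _ _ _ (normal_prob 0 sigma) X.
by [].
Qed.

Section weight.
Variable h : R -> R.
Hypothesis ch : continuous h.
Hypothesis h01 : forall x, 0 <= h x <= 1.

Lemma integrable_gauss_int (A : set R) : measurable A ->
  mu.-integrable A (EFin \o (fun y => h y * p y)).
Proof.
move=> mA; apply: (@integrableS _ _ _ _ setT) => //.
apply: (@le_integrable _ _ _ mu setT measurableT _ (EFin \o p)).
- apply/measurable_EFinP; apply: measurable_funM.
    exact: continuous_measurable_fun.
  exact: measurable_normal_pdf.
- move=> x _ /=; rewrite lee_fin normrM ler_piMl//.
  by have /andP[h0 h1] := h01 x; rewrite ger0_norm.
- exact: integrable_normal_pdf.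
Qed.

Lemma is_derive_gauss_int (x : R) :
  is_derive x 1 (fun y => gauss_int h `]-oo, y]) (h x * p x).
Proof.
have [||||dF FE] := @continuous_FTC1 R (fun y => h y * p y) -oo%O x (x + 1).
- by rewrite ltrDl.
- exact: integrable_gauss_int.
- by rewrite ltNyr.
- by apply: cvgM; [exact: ch|exact: continuous_normal_pdf].
- by move: FE; rewrite derive1E => FE; exact: (DeriveDef dF FE).
Qed.

Lemma gauss_int_ge0 A : 0 <= gauss_int h A.
Proof.
apply: Rintegral_ge0 => x _; rewrite mulr_ge0 ?(ltW (normal_pdf_gt0 _))//.
by case/andP: (h01 x).
Qed.

Lemma gauss_int_compl x :
  gauss_int h setT - gauss_int h `]-oo, x] = gauss_int h `]x, +oo[.
Proof.
rewrite /gauss_int -set_itvNyy Rintegral_itvB//.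
exact: integrable_gauss_int.
Qed.

End weight.

Lemma le_gauss_int (h g : R -> R) (A : set R) :
  measurable A -> continuous h -> continuous g ->
  (forall x, 0 <= h x <= 1) -> (forall x, 0 <= g x <= 1) ->
  (forall x, A x -> h x <= g x) -> gauss_int h A <= gauss_int g A.
Proof.
move=> mA ch cg h01 g01 hg; apply: le_Rintegral => //.
- exact: integrable_gauss_int.
- exact: integrable_gauss_int.
- by move=> x Ax; rewrite ler_wpM2r ?hg// ltW// normal_pdf_gt0.
Qed.

Let c1 : continuous (cst 1 : R -> R). Proof. by move=> x; exact: cvg_cst. Qed.
Let b1 (x : R) : 0 <= (cst 1 : R -> R) x <= 1. Proof. by rewrite /= ler01 lexx. Qed.

Lemma gauss_int1T : gauss_int (cst 1) setT = 1.
Proof.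
rewrite /gauss_int /Rintegral; under eq_integral do rewrite mul1r.
by rewrite integral_normal_pdf.
Qed.

Lemma is_derive_gauss_cdfr (x : R) : is_derive x 1 P (p x).
Proof.
have := is_derive_gauss_int c1 b1 x; rewrite mul1r.
by under eq_fun do rewrite -gauss_cdfrE.
Qed.

Section weight_bounds.
Variable h : R -> R.
Hypothesis ch : continuous h.
Hypothesis h01 : forall x, 0 <= h x <= 1.

Lemma gauss_int_le_cdfr x : gauss_int h `]-oo, x] <= P x.
Proof.
by rewrite gauss_cdfrE le_gauss_int// => y _; case/andP: (h01 y).
Qed.

Lemma gauss_int_tail_ge0 x : 0 <= gauss_int h setT - gauss_int h `]-oo, x].
Proof. by rewrite gauss_int_compl// gauss_int_ge0. Qed.

Lemma gauss_int_tail_le x :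
  gauss_int h setT - gauss_int h `]-oo, x] <= 1 - P x.
Proof.
rewrite -gauss_int1T gauss_cdfrE !gauss_int_compl//.
by rewrite le_gauss_int// => y _; case/andP: (h01 y).
Qed.

End weight_bounds.

End gauss.

(** * The Stein solution *)

Section gauss_estimates.
Context {R : realType}.
Variable sigma : R.
Hypothesis sigma_gt0 : 0 < sigma.

Local Notation p := (normal_pdf 0 sigma).
Local Notation P := (gauss_cdfr sigma).

Let sigma_neq0 : sigma != 0. Proof. by rewrite gt_eqF. Qed.
Let p_gt0 x : 0 < p x. Proof. exact: normal_pdf_gt0. Qed.

Lemma normal_peak_le : normal_peak sigma <= (2 * sigma)^-1.
Proof.
have s0 : 0 < 2 * sigma by rewrite mulr_gt0.
rewrite /normal_peak lef_pV2 ?posrE//; last first.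
  by rewrite sqrtr_gt0 pmulrn_rgt0// mulr_gt0 ?pi_gt0// exprn_gt0.
rewrite -[leLHS]gtr0_norm// -sqrtr_sqr ler_wsqrtr// -(mulr_natl _ 2).
by have := pi_ge2 R; have := exprn_gt0 2 sigma_gt0; nra.
Qed.

(** By [pi <= 16 / 5], as [(38 / 15)^2], about 6.418, exceeds [32 / 5]. *)
Lemma normal_peak_ge : (38 / 15 * sigma)^-1 <= normal_peak sigma.
Proof.
have s0 : 0 < 38 / 15 * sigma by rewrite mulr_gt0//; lra.
rewrite /normal_peak lef_pV2 ?posrE//; last first.
  by rewrite sqrtr_gt0 pmulrn_rgt0// mulr_gt0 ?pi_gt0// exprn_gt0.
rewrite -[leRHS]gtr0_norm// -sqrtr_sqr ler_wsqrtr// -(mulr_natl _ 2).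
by have := @pi_le_3_2 R; have := exprn_gt0 2 sigma_gt0; nra.
Qed.

Lemma is_derive_addZ (F G : R -> R) (k x a b : R) :
  is_derive x 1 F a -> is_derive x 1 G b ->
  is_derive x 1 (fun z => F z + k * G z) (a + k * b).
Proof. by move=> dF dG; exact: (is_deriveD dF (is_deriveZ k dG)). Qed.

(** Common source of both Mills bounds: with [x] frozen, this derivative is negative once [y] is
    beyond [x], on the side away from the origin. *)
Lemma gauss_tail_derive (x y : R) : x != 0 ->
  is_derive y 1 (fun z => P z + sigma ^+ 2 / x * p z) (p y * (1 - y / x)).
Proof.
move=> x0.
have dP := is_derive_gauss_cdfr sigma_gt0 y.
have dp := is_derive_normal_pdf sigma_gt0 y.
apply: (is_derive_eq (is_derive_addZ (sigma ^+ 2 / x) dP dp)).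
by move: (p y) => q; field; rewrite x0.
Qed.

Lemma mills_right x : 0 < x -> (1 - P x) * x <= sigma ^+ 2 * p x.
Proof.
move=> x0; have xn0 : x != 0 by rewrite gt_eqF.
(* The auxiliary function decreases beyond [x] and dominates [P], which tends to 1. *)
suff : 1 <= P x + sigma ^+ 2 / x * p x.
  rewrite -lerBlDl -ler_pdivlMr//; congr (_ <= _).
  by rewrite mulrAC.
apply: (cvgr_to_le (gauss_cdfr_cvgy sigma)).
near=> y; have xy : x <= y by near: y; apply: nbhs_pinfty_ge; rewrite num_real.
apply: (@le_trans _ _ (P y + sigma ^+ 2 / x * p y)).
  by rewrite lerDl mulr_ge0 ?divr_ge0 ?sqr_ge0// ltW.
apply: (derive_le0_ge xy (fun z => gauss_tail_derive z xn0)) => z /andP[xz _].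
rewrite pmulr_rle0// subr_le0 ler_pdivlMr// mul1r; exact: ltW.
Unshelve. all: by end_near. Qed.

Lemma mills_left x : x < 0 -> P x * (- x) <= sigma ^+ 2 * p x.
Proof.
move=> x0; have xn0 : x != 0 by rewrite lt_eqF.
have nx0 : 0 < - x by rewrite oppr_gt0.
(* Here the correction term is negative: the function decreases up to [x] and stays below [P], which
   tends to 0 at minus infinity. *)
suff : P x + sigma ^+ 2 / x * p x <= 0.
  rewrite -lerBrDr sub0r -ler_pdivlMr//; congr (_ <= _).
  by rewrite invrN mulrN mulrAC.
apply: (cvgr_to_ge (gauss_cdfr_cvgNy sigma)).
near=> y; have xy : y <= x by near: y; apply: nbhs_ninfty_le; rewrite num_real.
apply: (@le_trans _ _ (P y + sigma ^+ 2 / x * p y)).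
  apply: (derive_le0_ge xy (fun z => gauss_tail_derive z xn0)) => z /andP[_ zx].
  by rewrite pmulr_rle0// subr_le0 ler_ndivlMr// mul1r ltW.
rewrite gerDl -mulrA pmulr_rle0 ?exprn_gt0// pmulr_lle0// invr_le0 ltW//.
Unshelve. all: by end_near. Qed.

(** Beyond [5 / 6 * sigma] in absolute value a Mills bound suffices. Nearer the origin the left side
    is at most [1 / 4], and the density is bounded below through its peak and [expR y >= 1 + y]. *)
Lemma cdf_variance_le x : P x * (1 - P x) <= 6 / 5 * sigma * p x.
Proof.
have P0 := gauss_cdfr_ge0 sigma x; have P1 := gauss_cdfr_le1 sigma x.
have px := p_gt0 x; have s0 := sigma_gt0.
have tail c : 0 <= c -> c * (5 / 6 * sigma) <= sigma ^+ 2 * p x ->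
    c <= 6 / 5 * sigma * p x.
  by move=> c0 cle; rewrite -(ler_pM2r s0); lra.
have [xbig|xsmall] := leP (5 / 6 * sigma) `|x|.
  have [x0|x0] := leP 0 x.
    rewrite ger0_norm// in xbig.
    have xp : 0 < x by lra.
    have Mx := mills_right xp.
    apply: (@le_trans _ _ (1 - P x)); first by nra.
    by apply: tail; [lra|apply: le_trans Mx; rewrite ler_wpM2l//; lra].
  rewrite ltr0_norm// in xbig.
  have Mx := mills_left x0.
  apply: (@le_trans _ _ (P x)); first by nra.
  by apply: tail => //; apply: le_trans Mx; rewrite ler_wpM2l.
have Pq : P x * (1 - P x) <= 1 / 4 by have := sqr_ge0 (P x - 1 / 2); nra.
apply: le_trans Pq _.
rewrite normal_pdf0E//.
(* [47 / 72 = 1 - (5 / 6)^2 / 2]. *)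
have e1 : 47 / 72 <= expR (- (x ^+ 2 / (sigma ^+ 2 *+ 2))).
  apply: le_trans (expR_ge1Dx _).
  have xs : x ^+ 2 <= (5 / 6 * sigma) ^+ 2.
    by rewrite -[x ^+ 2]real_normK ?num_real// lerXn2r ?nnegrE// ltW// mulr_gt0//; lra.
  have : x ^+ 2 / (sigma ^+ 2 *+ 2) <= 25 / 72.
    rewrite ler_pdivrMr; last by rewrite pmulrn_rgt0// exprn_gt0.
    rewrite -(mulr_natl _ 2); lra.
  lra.
have e2 : 15 / 38 <= sigma * normal_peak sigma.
  have peak_ge := normal_peak_ge; rewrite -(ler_pM2l sigma_gt0) in peak_ge.
  apply: le_trans peak_ge.
  by rewrite invfM mulrCA divff// mulr1 invf_div.
have qE := ler_pM (ltW _) (ltW _) e2 e1.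
apply: (@le_trans _ _ (6 / 5 * (15 / 38 * (47 / 72)))); first lra.
rewrite -(mulrA (6 / 5)) (mulrA sigma) ler_wpM2l//; last by apply: qE; lra.
Qed.

(** * Explicit solution of the Stein equation and its bounds *)

Section stein_solution.
Variable h : R -> R.
Hypothesis ch : continuous h.
Hypothesis h01 : forall x, 0 <= h x <= 1.

Local Notation H x := (gauss_int sigma h `]-oo, x]).
Local Notation N := (gauss_int sigma h setT).

Definition stein_sol (x : R) : R := (H x - N * P x) / p x.
(** The Stein equation solved for [f']: it thus holds by unfolding, and what remains to be proved is
    that this is the derivative. *)
Definition stein_sol' (x : R) : R := h x - N + x / sigma ^+ 2 * stein_sol x.

Lemma is_derive_stein_sol (x : R) : is_derive x 1 stein_sol (stein_sol' x).
Proof.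
have dP := is_derive_gauss_cdfr sigma_gt0 x.
have dH := is_derive_gauss_int sigma_gt0 ch h01 x.
have dp := is_derive_normal_pdf sigma_gt0 x.
have px : p x != 0 by rewrite gt_eqF.
have dV := is_deriveV px dp.
have -> : stein_sol = ((fun y => H y) - N *: P) * (fun y => (p y)^-1) by [].
apply: (is_derive_eq (is_deriveM (is_deriveB dH (is_deriveZ N dP)) dV)).
rewrite /stein_sol' /stein_sol.
rewrite -[((fun y => H y) - N *: P) x]/(H x - N * P x).
move: (p x) (P x) (H x) N (h x) px => px Px Hx N hx px0.
by rewrite /GRing.scale/=; field; rewrite px0.
Qed.

Let solE x : stein_sol x * p x = H x * (1 - P x) - (N - H x) * P x.
Proof. by rewrite /stein_sol mulfVK ?gt_eqF//; ring. Qed.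

(** Times [p x], the solution is a difference of two terms lying between 0 and [P x * (1 - P x)],
    since [H <= P] and [N - H <= 1 - P]. *)
Lemma stein_sol_bound x : `|stein_sol x| <= 6 / 5 * sigma.
Proof.
rewrite -(ler_pM2r (p_gt0 x)) -[X in _ * X <= _]gtr0_norm// -normrM solE.
apply: le_trans (cdf_variance_le x).
have P0 := gauss_cdfr_ge0 sigma x; have P1 := gauss_cdfr_le1 sigma x.
have H0 := gauss_int_ge0 sigma_gt0 h01 `]-oo, x].
have HP := gauss_int_le_cdfr sigma_gt0 ch h01 x.
have NH0 := gauss_int_tail_ge0 sigma_gt0 ch h01 x.
have NH1 := gauss_int_tail_le sigma_gt0 ch h01 x.
by rewrite ler_norml; apply/andP; split; nra.
Qed.

(** The derivative is [h x] minus a combination of [H] and [N - H] whose weights [m1], [m2] are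
    nonnegative by the Mills bounds. As [P * m1 + (1 - P) * m2 = 1], that combination lies in
    [0, 1], like [h x]. *)
Lemma stein_sol'_bound x : `|stein_sol' x| <= 1.
Proof.
have P0 := gauss_cdfr_ge0 sigma x; have P1 := gauss_cdfr_le1 sigma x.
have H0 := gauss_int_ge0 sigma_gt0 h01 `]-oo, x].
have HP := gauss_int_le_cdfr sigma_gt0 ch h01 x.
have NH0 := gauss_int_tail_ge0 sigma_gt0 ch h01 x.
have NH1 := gauss_int_tail_le sigma_gt0 ch h01 x.
have /andP[h0 h1] := h01 x.
have px := p_gt0 x.
pose w := (sigma ^+ 2 * p x)^-1.
have s2p : 0 < sigma ^+ 2 * p x by rewrite mulr_gt0 ?exprn_gt0.
have w0 : 0 <= w by rewrite invr_ge0 ltW.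
have wE : sigma ^+ 2 * p x * w = 1 by rewrite divff// gt_eqF.
pose m1 := 1 - x * (1 - P x) * w.
pose m2 := 1 + x * P x * w.
have m1_ge0 : 0 <= m1.
  rewrite subr_ge0 -[leRHS]wE ler_wpM2r//.
  have [x0|x0] := ltP 0 x; last by nra.
  by rewrite [x * _]mulrC mills_right.
have m2_ge0 : 0 <= m2.
  rewrite /m2 -[X in _ <= X + _]wE -mulrDl mulr_ge0//.
  have [x0|x0] := ltP x 0; last by nra.
  by have := mills_left x0; nra.
have m12 : P x * m1 + (1 - P x) * m2 = 1 by rewrite /m1 /m2; ring.
have -> : stein_sol' x = h x - (H x * m1 + (N - H x) * m2).
  rewrite /stein_sol' /stein_sol /m1 /m2 /w; field.
  by rewrite sigma_neq0 gt_eqF.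
move: (m1) (m2) (H x) (N) m1_ge0 m2_ge0 m12 H0 HP NH0 NH1 => a b H N.
move=> *; rewrite ler_norml; apply/andP; split; nra.
Qed.

End stein_solution.
End gauss_estimates.

(** * Ramps *)

Section ramp.
Context {R : realType}.

(** Truncation to [0, 1], in a closed form whose continuity and Lipschitz constant come directly
    from the norm. *)
Definition clamp01 (z : R) : R := (1 + `|z| - `|z - 1|) / 2.

Lemma clamp01_bound z : 0 <= clamp01 z <= 1.
Proof.
rewrite /clamp01; have [z0|z0] := ger0P z; have [z1|z1] := ger0P (z - 1);
  apply/andP; split; lra.
Qed.

Lemma clamp01_le0 z : z <= 0 -> clamp01 z = 0.
Proof. by move=> z0; rewrite /clamp01 !ler0_norm; lra. Qed.

Lemma clamp01_ge1 z : 1 <= z -> clamp01 z = 1.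
Proof. by move=> z1; rewrite /clamp01 !ger0_norm; lra. Qed.

Lemma clamp01_id z : 0 <= z <= 1 -> clamp01 z = z.
Proof.
by move=> /andP[z0 z1]; rewrite /clamp01 ger0_norm// ler0_norm; lra.
Qed.

Lemma clamp01_lip z w : `|clamp01 z - clamp01 w| <= `|z - w|.
Proof.
have := ler_dist_dist z w; have := ler_dist_dist (z - 1) (w - 1).
rewrite (_ : z - 1 - (w - 1) = z - w); last by ring.
rewrite /clamp01 !ler_norml => /andP[? ?] /andP[? ?].
by apply/andP; split; lra.
Qed.

Variables a del : R.
Hypothesis del_gt0 : 0 < del.

Definition ramp (x : R) : R := clamp01 ((a + del - x) / del).

Lemma continuous_ramp : continuous ramp.
Proof.
have cz : continuous (fun x : R => (a + del - x) / del).
  move=> x; apply: cvgM; last exact: cvg_cst.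
  by apply: cvgB; [exact: cvg_cst|exact: cvg_id].
move=> x; rewrite /ramp /clamp01; apply: cvgM; last exact: cvg_cst.
apply: cvgB; [apply: cvgD; [exact: cvg_cst|]|]; apply: cvg_norm.
  exact: cz.
by apply: cvgB; [exact: cz|exact: cvg_cst].
Qed.

Lemma ramp_bound x : 0 <= ramp x <= 1.
Proof. exact: clamp01_bound. Qed.

Lemma ramp_eq1 x : x <= a -> ramp x = 1.
Proof.
by move=> xa; apply: clamp01_ge1; rewrite ler_pdivlMr// mul1r; lra.
Qed.

Lemma ramp_eq0 x : a + del <= x -> ramp x = 0.
Proof.
by move=> xa; apply: clamp01_le0; rewrite ler_pdivrMr// mul0r; lra.
Qed.

Lemma ramp_lin x : a <= x <= a + del -> ramp x = (a + del - x) / del.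
Proof.
move=> /andP[ax xa]; apply: clamp01_id.
by rewrite ler_pdivlMr// ler_pdivrMr// mul0r mul1r; apply/andP; split; lra.
Qed.

Lemma ramp_lip x y : `|ramp x - ramp y| <= `|x - y| / del.
Proof.
apply: le_trans (clamp01_lip _ _) _.
rewrite -mulrBl normrM normfV (gtr0_norm del_gt0).
by rewrite (_ : a + del - x - (a + del - y) = y - x) 1?distrC//; ring.
Qed.

Variable sigma : R.
Hypothesis sigma_gt0 : 0 < sigma.
Local Notation p := (normal_pdf 0 sigma).
Local Notation P := (gauss_cdfr sigma).
Local Notation H x := (gauss_int sigma ramp `]-oo, x]).
Local Notation N := (gauss_int sigma ramp setT).

Lemma gauss_int_ramp_lo : H a = P a.
Proof.
rewrite gauss_cdfrE; apply: eq_Rintegral => x.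
by rewrite inE/= in_itv/= => xa; rewrite ramp_eq1.
Qed.

Lemma gauss_int_ramp_hi : H (a + del) = N.
Proof.
apply/esym/eqP; rewrite -subr_eq0.
rewrite gauss_int_compl//; [|exact: continuous_ramp|exact: ramp_bound].
apply/eqP; rewrite /gauss_int (@eq_Rintegral _ _ _ _ _ (cst 0)).
  by rewrite Rintegral_cst// mul0r.
move=> x; rewrite inE/= in_itv/= andbT => xa.
by rewrite ramp_eq0 ?mul0r// ltW.
Qed.

Let p_le x : p x <= normal_peak sigma.
Proof. by rewrite normal_pdf_ub// gt_eqF. Qed.

Let dH (x : R) : is_derive x 1 (fun y => H y) (ramp x * p x).
Proof.
by apply: is_derive_gauss_int => //; [exact: continuous_ramp|exact: ramp_bound].
Qed.

Let dsqr (c x : R) : is_derive x 1 (fun y : R => (y - c) ^+ 2) (2 * (x - c)).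
Proof. by apply: is_derive_eq; rewrite /GRing.scale/=; ring. Qed.

Lemma gauss_int_ramp_le : N <= P a + normal_peak sigma * del / 2.
Proof.
rewrite -gauss_int_ramp_hi -gauss_int_ramp_lo.
(* With this [k] the square has derivative [- ramp * normal_peak] on the slope, so adding it to [H]
   gives a decreasing function. *)
set k := normal_peak sigma / (2 * del).
have dF (x : R) := is_derive_addZ k (dH x) (dsqr (a + del) x).
have aad : a <= a + del by rewrite lerDl ltW.
have := derive_le0_ge aad dF; rewrite subrr expr0n/= mulr0 addr0.
have -> : k * (a - (a + del)) ^+ 2 = normal_peak sigma * del / 2.
  by rewrite /k; field; rewrite gt_eqF.
apply => x /andP[ax xad].
have -> : k * (2 * (x - (a + del))) = - (ramp x * normal_peak sigma).
  by rewrite ramp_lin ?(ltW ax) ?(ltW xad)// /k; field; rewrite gt_eqF.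
rewrite -mulrBr; apply: mulr_ge0_le0; first by case/andP: (ramp_bound x).
by rewrite subr_le0.
Qed.

(** Same comparison for [P - H], the integral of [1 - ramp], with a square centred at [a]. *)
Lemma gauss_int_ramp_ge : P (a + del) - normal_peak sigma * del / 2 <= N.
Proof.
rewrite lerBlDl -lerBlDr -gauss_int_ramp_hi.
set k := - (normal_peak sigma / (2 * del)).
have dPH (x : R) := is_deriveB (is_derive_gauss_cdfr sigma_gt0 x) (dH x).
have dF (x : R) := is_derive_addZ k (dPH x) (dsqr a x).
have aad : a <= a + del by rewrite lerDl ltW.
have := derive_le0_ge aad dF.
rewrite -![(_ - _ : R -> R) _]/(_ - _) gauss_int_ramp_lo !subrr expr0n/=.
rewrite mulr0 addr0 (_ : k * _ = - (normal_peak sigma * del / 2)); last first.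
  by rewrite /k; field; rewrite gt_eqF.
rewrite subr_le0; apply => x /andP[ax xad].
have -> : k * (2 * (x - a)) = - ((1 - ramp x) * normal_peak sigma).
  by rewrite ramp_lin ?(ltW ax) ?(ltW xad)// /k; field; rewrite gt_eqF.
rewrite [leLHS](_ : _ = (1 - ramp x) * (p x - normal_peak sigma)); last first.
  by move: (ramp x) (p x) (normal_peak sigma) => r px q; ring.
apply: mulr_ge0_le0.
  by rewrite subr_ge0; case/andP: (ramp_bound x).
by rewrite subr_le0.
Qed.

Local Notation f := (stein_sol sigma ramp).
Local Notation f' := (stein_sol' sigma ramp).

Let cr := continuous_ramp.
Let br := ramp_bound.

(** By the Stein equation [f'] varies through the ramp, of slope [1 / del], and through
    [x f(x) / sigma^2]. The derivative [f + x f'] of [x f(x)] is controlled by the bounds on [f] and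
    [f']. *)
Lemma stein_sol'_lip M y z : `|y| <= M -> `|z| <= M ->
  `|f' y - f' z| <= `|y - z| * (del^-1 + (6 / 5 * sigma + M) / sigma ^+ 2).
Proof.
move=> yM zM.
have dxf (x : R) : is_derive x 1 (fun t => t * f t) (f x + x * f' x).
  apply: (is_derive_eq (is_deriveM (is_derive_id x 1)
    (is_derive_stein_sol sigma_gt0 cr br x))).
  by rewrite /GRing.scale/= mulr1 addrC.
have [c /andP[cmin cmax] cE] := mean_value y z dxf.
have cM : `|c| <= M.
  move: yM zM; rewrite !ler_norml => /andP[y1 y2] /andP[z1 z2].
  rewrite (le_trans _ cmin) ?le_min ?y1//= (le_trans cmax)//.
  by rewrite ge_max y2.
have s2 : 0 < sigma ^+ 2 by rewrite exprn_gt0.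
have -> : f' y - f' z =
    (ramp y - ramp z) + (y - z) * ((f c + c * f' c) / sigma ^+ 2).
  by rewrite mulrA -cE /stein_sol'; field; rewrite gt_eqF.
apply: (le_trans (ler_normD _ _)); rewrite [leRHS]mulrDr; apply: lerD; first exact: ramp_lip.
rewrite normrM ler_wpM2l// normrM normfV (gtr0_norm s2).
rewrite ler_wpM2r ?invr_ge0 ?(ltW s2)//.
apply: (le_trans (ler_normD _ _)); rewrite lerD ?stein_sol_bound//.
rewrite normrM -[M]mulr1 ler_pM//.
exact: stein_sol'_bound.
Qed.

(* [y] and [y'] are the two values that a Rademacher sum takes when the sign of
   its term [b] is flipped; the quadratic term, whose mean is explicit, comes
   from [|y| <= y^2 / (3 s) + 3 s / 4]. *)
Lemma stein_sol_trapezoid y y' b : y - y' = 2 * b ->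
  `|b * (f y - f y') / 2 - b ^+ 2 * ((f' y + f' y') / 2)| <=
  `|b| ^+ 3 * (del^-1 +
    (6 / 5 * sigma + ((y ^+ 2 + y' ^+ 2) / (3 * sigma) + 3 / 4 * sigma))
      / sigma ^+ 2).
Proof.
move=> yy'.
set M := (_ / (3 * sigma) + _).
have s0 := sigma_gt0.
have absM z w : `|z| <= (z ^+ 2 + w ^+ 2) / (3 * sigma) + 3 / 4 * sigma.
  have : 3 * sigma * `|z| <= z ^+ 2 + (3 / 2 * sigma) ^+ 2.
    have := sqr_ge0 (`|z| - 3 / 2 * sigma).
    by rewrite -[z ^+ 2]real_normK ?num_real//; nra.
  move=> zle; rewrite -(@ler_pM2l _ (3 * sigma)) ?mulr_gt0// mulrDr.
  rewrite mulrCA divff ?mulr1 ?mulf_neq0 ?gt_eqF//.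
  by have := sqr_ge0 w; nra.
have yM : `|y| <= M by exact: absM.
have y'M : `|y'| <= M by rewrite /M addrC [y ^+ 2 + _]addrC addrC; exact: absM.
(* Turns [b (f y - f y') / 2] into [b^2 f'(c)], to be compared with the average of [f'] at the
   endpoints. *)
have [c /andP[cmin cmax] fE] := mean_value y y' (is_derive_stein_sol sigma_gt0 cr br).
have cM : `|c| <= M.
  move: yM y'M; rewrite !ler_norml => /andP[y1 y2] /andP[z1 z2].
  rewrite (le_trans _ cmin) ?le_min ?y1//= (le_trans cmax)//.
  by rewrite ge_max y2.
set L := (_ + _ / _).
have L0 : 0 <= L.
  rewrite addr_ge0 ?invr_ge0 ?(ltW del_gt0)// divr_ge0 ?sqr_ge0// addr_ge0//.
    by rewrite mulr_ge0//; lra.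
  exact: le_trans yM.
(* As [c] lies between the endpoints, its distances to them add up to [|y - y'|]. *)
have cyy' : `|c - y| + `|c - y'| = 2 * `|b|.
  rewrite -[2 in RHS]gtr0_norm// -normrM -yy'.
  have /orP[yy|yy] := le_total y y'.
    rewrite (min_idPl yy) in cmin; rewrite (max_idPr yy) in cmax.
    by rewrite (ger0_norm (_ : 0 <= c - y)) ?(ler0_norm (_ : c - y' <= 0))
      ?(ler0_norm (_ : y - y' <= 0)); lra.
  rewrite (min_idPr yy) in cmin; rewrite (max_idPl yy) in cmax.
  by rewrite (ler0_norm (_ : c - y <= 0)) ?(ger0_norm (_ : 0 <= c - y'))
    ?(ger0_norm (_ : 0 <= y - y')); lra.
have -> : b * (f y - f y') / 2 - b ^+ 2 * ((f' y + f' y') / 2) =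
    b ^+ 2 * (((f' c - f' y) + (f' c - f' y')) / 2).
  by rewrite fE yy'; field.
rewrite normrM normrX [_ ^+ 3]exprSr -[leRHS]mulrA ler_wpM2l ?sqr_ge0//.
rewrite normrM [`|2^-1|]gtr0_norm ?invr_gt0// ler_pdivrMr//.
apply: (le_trans (ler_normD _ _)).
have l1 := stein_sol'_lip cM yM; have l2 := stein_sol'_lip cM y'M.
apply: (le_trans (lerD l1 l2)).
by rewrite -mulrDl cyy' (mulrC 2) mulrAC.
Qed.

End ramp.

(** * Rademacher sums *)

Section rademacher.
Context {R : realType} {n : nat}.
Implicit Types (F G : {ffun 'I_n -> bool} -> R) (s : {ffun 'I_n -> bool}).

Definition rmean F : R := (\sum_s F s) / (2 ^ n)%:R.

Let pow_neq0 : (2 ^ n)%:R != 0 :> R.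
Proof. by rewrite pnatr_eq0 expn_eq0. Qed.

Lemma rmeanD F G : rmean (fun s => F s + G s) = rmean F + rmean G.
Proof. by rewrite /rmean big_split mulrDl. Qed.

Lemma rmeanZ c F : rmean (fun s => c * F s) = c * rmean F.
Proof. by rewrite /rmean -mulr_sumr mulrA. Qed.

Lemma rmeanB F G : rmean (fun s => F s - G s) = rmean F - rmean G.
Proof. by rewrite /rmean sumrB mulrBl. Qed.

Lemma rmean_cst c : rmean (fun=> c) = c.
Proof.
by rewrite /rmean sumr_const card_ffun card_bool card_ord -(mulr_natr c) mulfK.
Qed.

Lemma rmean_sum (I : finType) (F : I -> {ffun 'I_n -> bool} -> R) :
  rmean (fun s => \sum_i F i s) = \sum_i rmean (F i).
Proof. by rewrite /rmean exchange_big mulr_suml. Qed.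

Lemma eq_rmean F G : F =1 G -> rmean F = rmean G.
Proof. by move=> FG; rewrite /rmean (eq_bigr _ (fun s _ => FG s)). Qed.

Lemma le_rmean F G : (forall s, F s <= G s) -> rmean F <= rmean G.
Proof.
by move=> FG; rewrite /rmean ler_wpM2r ?invr_ge0//; exact: ler_sum.
Qed.

Lemma rmean_unit_interval F :
  (forall s, 0 <= F s <= 1) -> 0 <= rmean F <= 1.
Proof.
move=> F01; have := @le_rmean (fun=> 0) F; have := @le_rmean F (fun=> 1).
by rewrite !rmean_cst => -> => [->//|] s; case/andP: (F01 s).
Qed.

Lemma ler_norm_rmean F : `|rmean F| <= rmean (fun s => `|F s|).
Proof.
rewrite /rmean normrM [`|_^-1|]ger0_norm ?invr_ge0// ler_wpM2r ?invr_ge0//.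
exact: ler_norm_sum.
Qed.

Definition rsign (b : bool) : R := if b then -1 else 1.

Lemma rsignN b : rsign (~~ b) = - rsign b.
Proof. by case: b; rewrite /= ?opprK. Qed.

Lemma rsign_sqr b : rsign b ^+ 2 = 1.
Proof. by case: b; rewrite /= ?sqrrN expr1n. Qed.

Lemma norm_rsign b : `|rsign b| = 1.
Proof. by case: b; rewrite /= ?normrN normr1. Qed.

Definition flip_sign (j : 'I_n) s : {ffun 'I_n -> bool} :=
  [ffun i => if i == j then ~~ s i else s i].

Lemma flipK j : involutive (flip_sign j).
Proof.
by move=> s; apply/ffunP => i; rewrite !ffunE; case: eqP => // _; rewrite negbK.
Qed.

Lemma rmean_flip j F : rmean (fun s => F (flip_sign j s)) = rmean F.
Proof.
rewrite /rmean; congr (_ / _); rewrite [RHS](reindex_inj (inv_inj (flipK j))).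
by apply: eq_bigr.
Qed.

Section rsum.
Variable a : 'I_n -> R.

Definition rterm j s : R := a j * rsign (s j).
Definition rsum s : R := \sum_j rterm j s.

Lemma rterm_flip j s : rterm j (flip_sign j s) = - rterm j s.
Proof. by rewrite /rterm ffunE eqxx rsignN mulrN. Qed.

Lemma rterm_sqr j s : rterm j s ^+ 2 = a j ^+ 2.
Proof. by rewrite exprMn rsign_sqr mulr1. Qed.

Lemma norm_rterm j s : `|rterm j s| = `|a j|.
Proof. by rewrite normrM norm_rsign mulr1. Qed.

Lemma rsum_flip j s : rsum s - rsum (flip_sign j s) = 2 * rterm j s.
Proof.
rewrite /rsum (bigD1 j)//= [in X in _ - X](bigD1 j)//= rterm_flip.
rewrite [X in _ - (_ + X)](_ : _ = \sum_(i < n | i != j) rterm i s).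
  by ring.
by apply: eq_bigr => i ij; rewrite /rterm ffunE (negbTE ij).
Qed.

(** Discrete integration by parts: flipping sign [j] preserves the uniform law and negates the [j]th
    term, so replacing [g(W)] by its flipped value negates the mean of the product. *)
Lemma rsum_ibp (g : R -> R) :
  rmean (fun s => rsum s * g (rsum s)) =
  \sum_j rmean (fun s => rterm j s * (g (rsum s) - g (rsum (flip_sign j s))) / 2).
Proof.
under eq_rmean do rewrite mulr_suml; rewrite rmean_sum; apply: eq_bigr => j _.
have E : rmean (fun s => rterm j s * g (rsum (flip_sign j s))) =
    - rmean (fun s => rterm j s * g (rsum s)).
  rewrite -(rmean_flip j) -mulN1r -rmeanZ; apply: eq_rmean => s.
  by rewrite flipK rterm_flip mulNr mulN1r.
under [RHS]eq_rmean => s do rewrite mulrC mulrBr.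
by rewrite rmeanZ rmeanB E opprK -mulr2n -(mulr_natl (rmean _)) mulKf.
Qed.

Lemma rmean_rsum_sqr : rmean (fun s => rsum s ^+ 2) = \sum_j a j ^+ 2.
Proof.
have := rsum_ibp id => ibp; under eq_rmean do rewrite expr2; rewrite ibp.
apply: eq_bigr => j _; rewrite -[RHS]rmean_cst; apply: eq_rmean => s.
by rewrite rsum_flip -(rterm_sqr j s); field.
Qed.

(** Integration by parts with the cube, then [y^2 + y y' + y'^2 <= 3 / 2 (y^2 + y'^2)], whose mean
    reduces to the second moment. *)
Lemma rmean_rsum_pow4 :
  rmean (fun s => rsum s ^+ 4) <= 3 * (\sum_j a j ^+ 2) ^+ 2.
Proof.
have := rsum_ibp (fun x => x ^+ 3) => ibp.
under eq_rmean do rewrite exprS; rewrite ibp expr2 mulrA [leRHS]mulrC.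
rewrite mulr_suml; apply: ler_sum => j _.
rewrite -rmean_rsum_sqr.
have -> : a j ^+ 2 * (3 * rmean (fun s => rsum s ^+ 2)) =
    rmean (fun s => 3 / 2 * a j ^+ 2 * (rsum s ^+ 2 + rsum (flip_sign j s) ^+ 2)).
  by rewrite rmeanZ rmeanD (rmean_flip j (fun s => rsum s ^+ 2)); field.
apply: le_rmean => s; rewrite -(rterm_sqr j s).
move: (rsum s) (rsum (flip_sign j s)) (rterm j s) (rsum_flip j s) => y y' b yE.
have -> : y = y' + 2 * b by rewrite -yE; ring.
(* The slack is [b^2 (y - y')^2 / 2], with [y - y' = 2 b]. *)
rewrite -subr_ge0 (_ : _ - _ = 2 * b ^+ 4); last by field.
by rewrite mulr_ge0// -[4%N]/(2 * 2)%N exprM sqr_ge0.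
Qed.

End rsum.
End rademacher.

(** * Normal approximation of a Rademacher sum by Stein's method *)

Section rademacher_normal.
Context {R : realType} {n : nat}.
Variables (a : 'I_n -> R) (sigma : R).
Hypothesis sigma_gt0 : 0 < sigma.
Hypothesis a_var : \sum_j a j ^+ 2 = sigma ^+ 2.

(** [157 / 60 = 6 / 5 + 3 / 4 + 2 / 3]: the bound on [f], the constant of the quadratic estimate,
    and the mean of its quadratic term, in which both sums have variance [sigma^2]. *)
Lemma stein_rademacher (c del : R) : 0 < del ->
  `|rmean (fun s => ramp c del (rsum a s)) - gauss_int sigma (ramp c del) setT|
  <= (\sum_j `|a j| ^+ 3) / sigma ^+ 2 * (del^-1 + 157 / 60 / sigma).
Proof.
move=> del_gt0.
set h := ramp c del; set N := gauss_int _ _ _.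
pose f := stein_sol sigma h; pose f' := stein_sol' sigma h.
have s2 : 0 < sigma ^+ 2 by rewrite exprn_gt0.
have key : sigma ^+ 2 * (rmean (fun s => h (rsum a s)) - N) =
    - \sum_j rmean (fun s => rterm a j s *
        (f (rsum a s) - f (rsum a (flip_sign j s))) / 2 -
      rterm a j s ^+ 2 * ((f' (rsum a s) + f' (rsum a (flip_sign j s))) / 2)).
  under eq_bigr do rewrite rmeanB.
  rewrite sumrB -rsum_ibp opprB.
  (* Both endpoints of each trapezoid have the same mean by flip invariance, and the squared weights
     add up to [sigma^2]. *)
  have -> : \sum_j rmean (fun s => rterm a j s ^+ 2 *
      ((f' (rsum a s) + f' (rsum a (flip_sign j s))) / 2)) =
      sigma ^+ 2 * rmean (fun s => f' (rsum a s)).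
    rewrite -a_var mulr_suml; apply: eq_bigr => j _.
    rewrite -rmeanZ.
    under eq_rmean => s do rewrite rterm_sqr mulrDl mulrDr mulrCA.
    rewrite rmeanD.
    rewrite (rmean_flip j (fun s => a j ^+ 2 * (f' (rsum a s) / 2))) -rmeanD.
    by apply: eq_rmean => s; field.
  rewrite -[N](@rmean_cst R n) -rmeanB -!rmeanZ -rmeanB; apply: eq_rmean => s.
  by rewrite /f' /stein_sol' -/f -/N; field; rewrite gt_eqF.
rewrite -(ler_pM2l s2) -[X in X * `|_|]gtr0_norm// -normrM key normrN.
apply: (le_trans (ler_norm_sum _ _ _)).
rewrite mulrA mulrCA divff ?gt_eqF// mulr1 mulr_suml.
apply: ler_sum => j _; apply: (le_trans (ler_norm_rmean _)).
apply: (@le_trans _ _ (rmean (fun s => `|a j| ^+ 3 * (del^-1 +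
  (6 / 5 * sigma + 3 / 4 * sigma) / sigma ^+ 2 +
  (3 * sigma ^+ 3)^-1 * (rsum a s ^+ 2 + rsum a (flip_sign j s) ^+ 2))))).
  apply: le_rmean => s.
  have := stein_sol_trapezoid c del_gt0 sigma_gt0 (rsum_flip a j s).
  rewrite norm_rterm => /le_trans; apply.
  rewrite ler_wpM2l ?exprn_ge0//.
  by rewrite le_eqVlt; apply/orP; left; apply/eqP; field; rewrite !gt_eqF.
rewrite rmeanZ rmeanD rmean_cst rmeanZ rmeanD.
rewrite (rmean_flip j (fun s => rsum a s ^+ 2)) rmean_rsum_sqr a_var.
rewrite le_eqVlt; apply/orP; left; apply/eqP.
by congr (_ * _); field; rewrite !gt_eqF.
Qed.

(** The indicator of [x <= t] lies between the ramps starting at [t - del] and at [t]; smoothing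
    costs at most [del / (4 sigma)] of Gaussian mass on each side. *)
Lemma rademacher_cdf_close (t del : R) : 0 < del ->
  `|rmean (fun s => (rsum a s <= t)%R%:R) - gauss_cdfr sigma t|
  <= del / (4 * sigma) +
     (\sum_j `|a j| ^+ 3) / sigma ^+ 2 * (del^-1 + 157 / 60 / sigma).
Proof.
move=> del_gt0; set B := (_ / _ * _).
have peak : normal_peak sigma * del / 2 <= del / (4 * sigma).
  rewrite [leRHS](_ : _ = (2 * sigma)^-1 * del / 2).
    by rewrite ler_pM2r// ler_pM2r// normal_peak_le.
  by field; rewrite gt_eqF.
have := stein_rademacher t del_gt0.
have := stein_rademacher (t - del) del_gt0.
rewrite -/B !ler_norml => /andP[lo _] /andP[_ hi].
have hiN := gauss_int_ramp_le t del_gt0 sigma_gt0.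
have loN := gauss_int_ramp_ge (t - del) del_gt0 sigma_gt0.
rewrite subrK in loN.
have hi1 : rmean (fun s => (rsum a s <= t)%R%:R) <=
    rmean (fun s => ramp t del (rsum a s)).
  apply: le_rmean => s; case: (leP (rsum a s) t) => [st|_].
    by rewrite ramp_eq1.
  by case/andP: (ramp_bound t del (rsum a s)).
have lo1 : rmean (fun s => ramp (t - del) del (rsum a s)) <=
    rmean (fun s => (rsum a s <= t)%R%:R).
  apply: le_rmean => s; case: (leP (rsum a s) t) => [_|st].
    by case/andP: (ramp_bound (t - del) del (rsum a s)).
  by rewrite ramp_eq0// subrK ltW.
by apply/andP; split; lra.
Qed.

End rademacher_normal.

(** * The Hadamard projection *)

Section hadamard_projection.
Context {R : realType}.

Local Notation hd := (@hadamard_entry R).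

Lemma hadamard_entry_sqr m i j : hd m i j ^+ 2 = 1.
Proof.
elim: m i j => [|m IH] i j /=; first by rewrite expr1n.
by rewrite exprMn IH mulr1; case: ifP; rewrite ?sqrrN expr1n.
Qed.

(** Induction on the block structure: the two halves of the rows give the same inner product up to a
    sign, which is negative exactly when the columns lie in different halves. *)
Lemma hadamard_entry_orth m i i' : (i < 2 ^ m)%N -> (i' < 2 ^ m)%N ->
  \sum_(0 <= j < 2 ^ m) hd m j i * hd m j i' = (2 ^ m)%:R * (i == i')%:R.
Proof.
elim: m i i' => [|m IH] i i'.
  by rewrite expn0 !ltnS !leqn0 => /eqP-> /eqP->; rewrite big_nat1 /= !mulr1.
have n_gt0 : (0 < 2 ^ m)%N by rewrite expn_gt0.
move: (n_gt0) (IH) => /=; set n := (2 ^ m)%N => ngt0 {}IH.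
rewrite expnS mul2n -addnn => ilt i'lt.
(* Below [2 n] the quotient by [n] is a single bit, here the test [n <= k]. *)
have modE k : (k < n + n)%N -> k = ((n <= k) * n + k %% n)%N.
  move=> klt; case: (leqP n k) => nk; last by rewrite modn_small.
  have -> : (k %% n = k - n)%N.
    by rewrite -{1}(subnK nk) modnDr modn_small// ltn_subLR.
  by rewrite mul1n subnKC.
rewrite (@big_cat_nat _ _ _ n)//= ?leq_addr//.
have -> : \sum_(n <= j < n + n)
    (if (n <= j)%N && (n <= i)%N then -1 else 1) * hd m (j %% n) (i %% n) *
    ((if (n <= j)%N && (n <= i')%N then -1 else 1) * hd m (j %% n) (i' %% n)) =
    (-1) ^+ (n <= i)%N * (-1) ^+ (n <= i')%N *
    \sum_(0 <= j < n) hd m j (i %% n) * hd m j (i' %% n).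
  rewrite -{1}[n]add0n big_addn addnK mulr_sumr; apply: eq_big_nat => j /andP[_ jn].
  rewrite leq_addl modnDr modn_small//=.
  by case: (leqP n i) => _; case: (leqP n i') => _; rewrite ?expr1 ?expr0; ring.
have -> : \sum_(0 <= j < n)
    (if (n <= j)%N && (n <= i)%N then -1 else 1) * hd m (j %% n) (i %% n) *
    ((if (n <= j)%N && (n <= i')%N then -1 else 1) * hd m (j %% n) (i' %% n)) =
    \sum_(0 <= j < n) hd m j (i %% n) * hd m j (i' %% n).
  apply: eq_big_nat => j /andP[_ jn].
  by rewrite leqNgt jn /= !mul1r modn_small.
rewrite !IH ?ltn_pmod//.
rewrite [i in RHS]modE// [i' in RHS]modE//.
have [->|ne] := eqVneq (i %% n)%N (i' %% n)%N; last first.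
  rewrite !mulr0 addr0 (_ : (_ == _) = false) ?mulr0//.
  apply/eqP => /(congr1 (fun k => k %% n)%N).
  by rewrite !modnMDl !modn_mod => /eqP; rewrite (negbTE ne).
rewrite eqn_add2r eqn_pmul2r//.
by case: (leqP n i) => _; case: (leqP n i') => _;
  rewrite /= ?expr1 ?expr0 natrD; ring.
Qed.

Variables (m : nat) (u : 'cV[R]_(2 ^ m)) (k : 'I_(2 ^ m)).
Local Notation d := (2 ^ m)%N.
Hypothesis u1 : \sum_i u i ord0 ^+ 2 = 1.

Definition hadamard_coeff (s : {ffun 'I_d -> bool}) (j : 'I_d) : R :=
  d%:R^-1 * hd m k j * rsum (fun i : 'I_d => hd m j i * u i ord0) s.

Lemma Tmap_rsum (s1 s2 : {ffun 'I_d -> bool}) :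
  Tmap s1 s2 u k ord0 = rsum (hadamard_coeff s2) s1.
Proof.
rewrite /Tmap -!mulmxA !mxE mulr_sumr /rsum; apply: eq_bigr => j _.
rewrite /rad_diag mul_diag_mx !mxE /rterm /hadamard_coeff.
rewrite -!mulrA; congr (_ * (_ * _)); rewrite mulrC; congr (_ * _).
apply: eq_bigr => i _; rewrite mul_diag_mx !mxE /rterm -mulrA; congr (_ * _).
by rewrite mulrC.
Qed.

Let d_neq0 : d%:R != 0 :> R. Proof. by rewrite pnatr_eq0 expn_eq0. Qed.

(** True for every sign pattern, not only on average: signs preserve the norm of [u] and [H]
    multiplies squared norms by [d]. Hence one Gaussian serves all inner signs. *)
Lemma hadamard_coeff_var s : \sum_j hadamard_coeff s j ^+ 2 = d%:R^-1.
Proof.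
under eq_bigr do rewrite !exprMn hadamard_entry_sqr mulr1.
rewrite -mulr_sumr.
suff -> : \sum_(j < d) rsum (fun i : 'I_d => hd m j i * u i ord0) s ^+ 2 = d%:R.
  by rewrite expr2 -mulrA mulVf// mulr1.
under eq_bigr do rewrite expr2 mulr_suml.
under eq_bigr => j do under eq_bigr => i do rewrite mulr_sumr.
rewrite exchange_big/=.
rewrite -[RHS]mulr1 -[X in _ = _ * X]u1 mulr_sumr; apply: eq_bigr => i _.
rewrite exchange_big/= (bigD1 i)//= [X in _ + X]big1 ?addr0.
  have -> : d%:R * u i ord0 ^+ 2 = \sum_(j < d) (u i ord0 ^+ 2).
    by rewrite sumr_const card_ord mulr_natl.
  apply: eq_bigr => j _; rewrite -expr2 rterm_sqr exprMn hadamard_entry_sqr.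
  by rewrite mul1r.
move=> i' ii'.
have -> : \sum_(j < d) rterm (fun i : 'I_d => hd m j i * u i ord0) i s *
    rterm (fun i : 'I_d => hd m j i * u i ord0) i' s =
  u i ord0 * rsign (s i) * (u i' ord0 * rsign (s i')) *
    \sum_(0 <= j < d) hd m j i * hd m j i'.
  rewrite big_mkord mulr_sumr; apply: eq_bigr => j _.
  by rewrite /rterm; ring.
rewrite hadamard_entry_orth// (_ : (_ == _) = false) ?mulr0//.
by apply/negbTE; move: ii'; rewrite eq_sym.
Qed.

(** Up to the factor of modulus [1 / d], the coefficient is a Rademacher sum of variance 1 in the
    inner signs. *)
Lemma hadamard_coeff_pow4 j :
  rmean (fun s => hadamard_coeff s j ^+ 4) <= 3 / d%:R ^+ 4.
Proof.
have -> : rmean (fun s => hadamard_coeff s j ^+ 4) = d%:R^-1 ^+ 4 *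
    rmean (fun s => rsum (fun i : 'I_d => hd m j i * u i ord0) s ^+ 4).
  rewrite -rmeanZ; apply: eq_rmean => s; rewrite !exprMn.
  have -> : hd m k j ^+ 4 = (hd m k j ^+ 2) ^+ 2 by rewrite -exprM.
  by rewrite hadamard_entry_sqr expr1n mulr1.
rewrite mulrC -exprVn ler_wpM2r ?exprn_ge0 ?invr_ge0//.
apply: (le_trans (rmean_rsum_pow4 _)).
under eq_bigr do rewrite exprMn hadamard_entry_sqr mul1r.
by rewrite u1 expr1n mulr1.
Qed.

(* AM-GM: [|a|^3 <= (l a^4 + a^2 / l) / 2] with [l = 4 d / 7], the rational
   [7 / 4] standing for [sqrt 3]. *)
Lemma hadamard_coeff_pow3 :
  rmean (fun s => \sum_j `|hadamard_coeff s j| ^+ 3) <= 97 / 56 / d%:R ^+ 2.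
Proof.
have d0 : 0 < d%:R :> R by rewrite ltr0n expn_gt0.
apply: (@le_trans _ _ (rmean (fun s =>
    2 / 7 * d%:R * (\sum_j hadamard_coeff s j ^+ 4) + 7 / 8 / d%:R ^+ 2))).
  apply: le_rmean => s.
  have -> : 7 / 8 / d%:R ^+ 2 =
      \sum_j (7 / 8 / d%:R * hadamard_coeff s j ^+ 2) :> R.
    by rewrite -mulr_sumr hadamard_coeff_var; field.
  rewrite mulr_sumr -big_split/=; apply: ler_sum => j _.
  have -> : hadamard_coeff s j ^+ 4 = (hadamard_coeff s j ^+ 2) ^+ 2.
    by rewrite -exprM.
  rewrite -(real_normK (num_real (hadamard_coeff s j))).
  move: `|_| (normr_ge0 (hadamard_coeff s j)) => b b0.
  rewrite -subr_ge0.
  have -> : 2 / 7 * d%:R * (b ^+ 2) ^+ 2 + 7 / 8 / d%:R * b ^+ 2 - b ^+ 3 =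
      (4 / 7 * d%:R * b - 1) ^+ 2 * b ^+ 2 * (7 / 8 / d%:R) by field.
  by rewrite mulr_ge0 ?divr_ge0 ?ler0n// mulr_ge0 ?sqr_ge0.
rewrite rmeanD rmean_cst rmeanZ rmean_sum.
apply: (@le_trans _ _
  (2 / 7 * d%:R * (\sum_(j < d) 3 / d%:R ^+ 4) + 7 / 8 / d%:R ^+ 2)).
  rewrite lerD2r ler_wpM2l ?mulr_ge0 ?invr_ge0//.
  by apply: ler_sum => j _; exact: hadamard_coeff_pow4.
(* [97 / 56 = 2 / 7 * 3 + 7 / 8]. *)
rewrite sumr_const card_ord -mulr_natl le_eqVlt; apply/orP; left; apply/eqP.
by field.
Qed.

Lemma prob_T_le_rmean t : prob_T_le u k t =
  rmean (fun s2 => rmean (fun s1 => (rsum (hadamard_coeff s2) s1 <= t)%R%:R)).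
Proof.
rewrite /prob_T_le /rmean -mulr_suml -mulrA -invfM -natrM -expnD addnn -mul2n.
congr (_ / _); rewrite exchange_big pair_bigA/= -sum1_card natr_sum big_mkcond.
apply: eq_bigr => -[s1 s2] _; rewrite inE /= Tmap_rsum.
by case: ifP.
Qed.

Lemma gauss_cdfE (t : R) : gauss_cdf d t = (gauss_cdfr (Num.sqrt d%:R^-1) t)%:E.
Proof. by rewrite /gauss_cdf gauss_cdfr_EFin. Qed.

(** Here [del] is in units of the standard deviation: the ramp has width [sigma * del]. The
    conditional bound is averaged over the inner signs through the third moment. *)
Lemma prob_T_le_close (t del : R) (sigma := Num.sqrt (d%:R^-1)) : 0 < del ->
  `|prob_T_le u k t - gauss_cdfr sigma t| <=
  del / 4 + 97 / 56 * sigma * (del^-1 + 157 / 60).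
Proof.
move=> del0.
have d0 : 0 < d%:R :> R by rewrite ltr0n expn_gt0.
have s0 : 0 < sigma by rewrite sqrtr_gt0 invr_gt0.
have s2 : sigma ^+ 2 = d%:R^-1 by rewrite sqr_sqrtr// invr_ge0 ltW.
have dE : d%:R = (sigma ^+ 2)^-1 by rewrite s2 invrK.
rewrite prob_T_le_rmean -(@rmean_cst R d (gauss_cdfr sigma t)) -rmeanB.
apply: (le_trans (ler_norm_rmean _)).
apply: (@le_trans _ _ (rmean (fun s2 =>
    del / 4 + (sigma ^+ 2)^-1 * ((sigma * del)^-1 + 157 / 60 / sigma) *
      (\sum_j `|hadamard_coeff s2 j| ^+ 3)))).
  apply: le_rmean => r.
  have sd : 0 < sigma * del by rewrite mulr_gt0.
  have var : \sum_j hadamard_coeff r j ^+ 2 = sigma ^+ 2.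
    by rewrite hadamard_coeff_var s2.
  apply: (le_trans (rademacher_cdf_close s0 var t sd)).
  rewrite le_eqVlt; apply/orP; left; apply/eqP.
  by move: (\sum_j _) => S; field; rewrite !gt_eqF.
rewrite rmeanD rmean_cst rmeanZ lerD2l.
apply: (@le_trans _ _ ((sigma ^+ 2)^-1 * ((sigma * del)^-1 + 157 / 60 / sigma) *
    (97 / 56 / d%:R ^+ 2))).
  rewrite ler_wpM2l ?hadamard_coeff_pow3// mulr_ge0 ?invr_ge0 ?sqr_ge0//.
  by rewrite addr_ge0 ?divr_ge0 ?invr_ge0 ?mulr_ge0 ?ltW//.
rewrite dE le_eqVlt; apply/orP; left; apply/eqP.
by field; rewrite !gt_eqF.
Qed.

End hadamard_projection.

(** * The constant [C_G] and the rate *)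

Section constant.
Context {R : realType}.


Lemma powR_fifth_pow5 (x : R) (k : nat) : 0 <= x ->
  (x `^ (k%:R / 5)) ^+ 5 = x ^+ k.
Proof.
move=> x0; rewrite -powR_mulrn ?powR_ge0// -powRrM.
by rewrite divfK ?pnatr_eq0// powR_mulrn.
Qed.

(** Fifth powers remove the fractional exponents, leaving [(23 / 10)^5 * pi^7 <= 5^5 * 3^4]. *)
Lemma C_G_ge : 23 / 10 <= C_G :> R.
Proof.
have p0 : 0 < (pi : R) `^ (7 / 5) by rewrite powR_gt0 ?pi_gt0.
rewrite /C_G ler_pdivlMr//.
have y0 : 0 <= 5 * (3 : R) `^ (4 / 5) by rewrite mulr_ge0 ?powR_ge0.
have l0 : 0 <= 23 / 10 * (pi : R) `^ (7 / 5).
  by rewrite mulr_ge0 ?powR_ge0 ?divr_ge0.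
rewrite -(@ler_pXn2r _ 5) ?nnegrE// !exprMn !powR_fifth_pow5 ?pi_ge0//.
have : (pi : R) ^+ 7 <= (16 / 5) ^+ 7.
  by rewrite lerXn2r ?nnegrE ?pi_ge0 ?pi_le_3_2// divr_ge0.
lra.
Qed.

(** The threshold 64 fits because [(23 / 10)^5] is about 64.36. *)
Lemma C_G_rate_ge1 (w : R) : 0 <= w -> 1 / 64 <= w ^+ 5 -> 1 <= C_G * w.
Proof.
move=> w0 w5; apply: (@le_trans _ _ (23 / 10 * w)); last first.
  by rewrite ler_wpM2r ?C_G_ge.
have l0 : 0 <= 23 / 10 * w by rewrite mulr_ge0 ?divr_ge0.
rewrite -(@ler_pXn2r _ 5) ?nnegrE// exprMn expr1n; lra.
Qed.

Lemma C_G_rate_ge_error (w sigma : R) : 0 < w -> w ^+ 5 = sigma ^+ 2 ->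
  0 <= sigma -> w ^+ 5 <= 1 / 128 ->
  2 * w / 4 + 97 / 56 * sigma * ((2 * w)^-1 + 157 / 60) <= C_G * w.
Proof.
move=> w0 ws s0 wle.
(* With [w = x^2] and [sigma = x^5], the error divided by [w] is a polynomial increasing in
   [x >= 0]. *)
pose x := Num.sqrt w.
have x0 : 0 < x by rewrite sqrtr_gt0.
have wE : w = x ^+ 2 by rewrite sqr_sqrtr// ltW.
have sE : sigma = x ^+ 5.
  apply/eqP; rewrite -(@eqrXn2 _ 2) ?exprn_ge0 ?(ltW x0)//.
  by rewrite -ws wE -!exprM.
(* [(31 / 50)^10], about 0.0084, exceeds [1 / 128]. *)
have xle : x <= 31 / 50.
  rewrite -(@ler_pXn2r _ 10) ?nnegrE ?(ltW x0) ?divr_ge0//.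
  have -> : x ^+ 10 = w ^+ 5 by rewrite wE -exprM.
  by apply: (le_trans wle); lra.
apply: (@le_trans _ _ (23 / 10 * w)); last by rewrite ler_wpM2r ?C_G_ge// ltW.
rewrite wE sE.
have -> : 2 * x ^+ 2 / 4 + 97 / 56 * x ^+ 5 * ((2 * x ^+ 2)^-1 + 157 / 60) =
    (1 / 2 + 97 / 56 * (x / 2 + 157 / 60 * x ^+ 3)) * x ^+ 2.
  by field; rewrite gt_eqF.
rewrite ler_wpM2r ?sqr_ge0//.
have : x ^+ 3 <= (31 / 50) ^+ 3.
  by rewrite lerXn2r ?nnegrE ?(ltW x0)// divr_ge0.
lra.
Qed.

End constant.

Theorem mainTheorem3 (R : realType) (m : nat) (hm : (1 <= m)%N)
  (u : 'cV[R]_(2 ^ m)) (hu : \sum_i u i ord0 ^+ 2 = 1)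
  (k : 'I_(2 ^ m)) (t : R) :
  (`| (prob_T_le u k t)%:E - gauss_cdf (2 ^ m) t | <=
     (C_G * ((2 ^ m)%:R `^ (- (1 / 5))))%:E)%E.
Proof.
rewrite gauss_cdfE -EFinB abse_EFin lee_fin.
set d : R := (2 ^ m)%:R; set w := d `^ _; set sigma := Num.sqrt _.
have d0 : 0 < d by rewrite ltr0n expn_gt0.
have w0 : 0 < w by rewrite powR_gt0.
have w5 : w ^+ 5 = d^-1.
  rewrite /w powRN exprVn; congr (_^-1).
  exact: (@powR_fifth_pow5 R d 1 (ltW d0)).
(* For [d <= 64] the bound is at least 1 and trivial; from [d = 128] on, the Stein estimate applies
   with [del = 2 w]. *)
have [m6|m7] := leqP m 6.
  apply: (@le_trans _ _ 1); last first.
    apply: C_G_rate_ge1; first exact: ltW.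
    rewrite w5 div1r lef_pV2 ?posrE//.
    by rewrite -[64%R]/((2 ^ 6)%:R) ler_nat leq_exp2l.
  have P0 := gauss_cdfr_ge0 sigma t; have P1 := gauss_cdfr_le1 sigma t.
  have /andP[T0 T1] : 0 <= prob_T_le u k t <= 1.
    rewrite prob_T_le_rmean; apply: rmean_unit_interval => s2.
    by apply: rmean_unit_interval => s1; rewrite ler0n lern1 leq_b1.
  by rewrite ler_norml; apply/andP; split; lra.
have s2 : sigma ^+ 2 = d^-1 by rewrite sqr_sqrtr// invr_ge0 ltW.
have del0 : 0 < 2 * w by rewrite mulr_gt0.
apply: (le_trans (prob_T_le_close k hu t del0)).
apply: C_G_rate_ge_error => //; first by rewrite w5 s2.
rewrite w5 div1r lef_pV2 ?posrE//.
by rewrite -[128%R]/((2 ^ 7)%:R) ler_nat leq_exp2l.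
Qed.
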